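(* For every integer $n\ge 2$ and every generic set $X$ of $n$ points in $\mathbb{R}^2$, $$\mathrm{span}_2(X)\le \Big\lfloor \frac{n^2}{4}+n-2\Big\rfloor .$$ Moreover this bound is best possible: for every $n\ge 2$ there is a generic set $X$ of $n$ points in $\mathbb{R}^2$ with $\mathrm{span}_2(X)=\lfloor \frac{n^2}{4}+n-2\rfloor$.
   Context: A rectangle is a closed axis-aligned rectangle in $\mathbb{R}^2$. A finite set $X\subset\mathbb{R}^2$ is generic if no two points of $X$ share a coordinate (i.e. have equal first coordinates or equal second coordinates). For $A\subseteq X$, $R[A]$ denotes the smallest rectangle containing $A$, i.e. $\{s\in\mathbb{R}^2: \min_{x\in A}x_i\le s_i\le \max_{x\in A}x_i,\ i=1,2\}$. A rectangle is empty (with respect to $X$) if its open interior contains no point of $X$. The rectangle graph $G_r(X)$ has vertex set $X$, and $p,q\in X$ are adjacent iff $R[\{p,q\}]$ is empty. $\mathrm{span}_2(X)$ denotes the number of edges of $G_r(X)$. *)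

(* Defs.v *)
From HB Require Import structures.
From mathcomp Require Import all_boot all_order all_algebra finmap.
From mathcomp Require Import all_classical all_reals all_analysis.

Set Implicit Arguments.
Unset Strict Implicit.
Unset Printing Implicit Defensive.

Import Order.TTheory GRing.Theory Num.Theory.
Import numFieldNormedType.Exports.

Local Open Scope fset_scope.
Local Open Scope classical_set_scope.
Local Open Scope ring_scope.

Definition rectangle (R : realType) (S : set (R * R)) : Prop :=
  exists a b : R * R,
    [/\ a.1 <= b.1, a.2 <= b.2 & S = `[a.1, b.1] `*` `[a.2, b.2]].

Definition generic (R : realType) (X : {fset R * R}) : Prop :=
  forall p q, p \in X -> q \in X -> p != q -> p.1 != q.1 /\ p.2 != q.2.

(* For nonempty A the intersection of all rectangles containing A is itself a
   rectangle: the bounding box given by the coordinatewise minima and maxima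
   over A. *)
Definition hull_rectangle (R : realType) (A : {fset R * R}) : set (R * R) :=
  smallest (@rectangle R) [set` A].

Definition empty_rectangle (R : realType) (X : {fset R * R})
    (S : set (R * R)) : Prop :=
  interior S `&` [set` X] = set0.

(* The graph is simple: without p != q every vertex would carry a loop, since
   a one-point rectangle has empty interior. *)
Definition rectangle_graph (R : realType) (X : {fset R * R}) (p q : R * R) :
    Prop :=
  [/\ p \in X, q \in X, p != q &
      empty_rectangle X (hull_rectangle [fset p; q])].

Definition rectangle_graph_edges (R : realType) (X : {fset R * R}) :
    {fset {fset R * R}} :=
  [fset e in fpowerset X |
    `[< exists p q, rectangle_graph X p q /\ e = [fset p; q] >]].

Definition span2 (R : realType) (X : {fset R * R}) : nat :=
  #|` rectangle_graph_edges X|.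

(* Main.v *)
(* Upper bound: let p be the leftmost point and q its rightmost neighbour. A
   common neighbour of p and q lies strictly between them in the first
   coordinate, and outside R[p,q], hence above both or below both; two of them
   on the same side would block each other, so there are at most two. Deleting p
   and q therefore removes at most n + 1 edges (at most 2n - 3 if n <= 4), and
   one concludes by induction on n in steps of two.
   Sharpness: take two decreasing chains of sizes floor(n/2) and ceil(n/2), the
   second one above and to the right of the first. All pairs across the chains
   and all consecutive pairs within a chain are edges. *)
Require Import Defs.
From HB Require Import structures.
From mathcomp Require Import all_boot all_order all_algebra finmap.
From mathcomp Require Import all_classical all_reals all_analysis.
From mathcomp Require Import zify lra.

Import Order.TTheory GRing.Theory Num.Theory.
Import numFieldNormedType.Exports.

Local Open Scope fset_scope.
Local Open Scope ring_scope.

(** * Adjacency in terms of coordinates *)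

Definition strictly_between {R : realType} (a b c : R) : bool :=
  (a < b < c) || (c < b < a).

Definition inside_box {R : realType} (p q r : R * R) : bool :=
  strictly_between p.1 r.1 q.1 && strictly_between p.2 r.2 q.2.

Lemma hull_rectangle2 (R : realType) (p q : R * R) :
  hull_rectangle [fset p; q] =
  (`[Num.min p.1 q.1, Num.max p.1 q.1] `*`
   `[Num.min p.2 q.2, Num.max p.2 q.2])%classic.
Proof.
apply/seteqP; split.
  apply: smallest_sub.
    exists (Num.min p.1 q.1, Num.min p.2 q.2).
    exists (Num.max p.1 q.1, Num.max p.2 q.2).
    by split=> //=; rewrite ge_min !le_max lexx.
  by move=> r /= /fset2P[] ->; rewrite !in_itv /= !ge_min !le_max !lexx ?orbT.
move=> r [/= r1 r2] M [[a [b [ab1 ab2 ->]]] sub].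
have [/= p1 p2] := sub p (fset21 p q).
have [/= q1 q2] := sub q (fset22 p q).
move: r1 r2 p1 p2 q1 q2; rewrite !in_itv /= !ge_min !le_max.
move=> /andP[r1 r1'] /andP[r2 r2'] /andP[p1 p1'] /andP[p2 p2'].
move=> /andP[q1 q1'] /andP[q2 q2'].
have between (x y z l u : R) : l <= x -> x <= u -> l <= y -> y <= u ->
    (x <= z) || (y <= z) -> (z <= x) || (z <= y) -> l <= z <= u.
  by move=> lx xu ly yu /orP[] xz /orP[] zx; apply/andP; split; lra.
by split; rewrite /=; [exact: (between p.1 q.1)|exact: (between p.2 q.2)].
Qed.

Lemma interior_setX (T U : topologicalType) (A : set T) (B : set U) :
  (interior (A `*` B) = interior A `*` interior B)%classic.
Proof.
apply/seteqP; split=> [[x y] [[P Q] /= [Px Qy] PQ]|[x y] [/= Ax By]].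
- split=> /=.
    by apply: filterS Px => z Pz; have [] := PQ (z, y) (conj Pz (nbhs_singleton Qy)).
  by apply: filterS Qy => z Qz; have [] := PQ (x, z) (conj (nbhs_singleton Px) Qz).
- by exists (A, B).
Qed.

Lemma itv_min_max_strictly_between {R : realType} (a b c : R) :
  (b \in `]Num.min a c, Num.max a c[) = strictly_between a b c.
Proof.
rewrite in_itv /= /strictly_between; case: (ltgtP a c) => ac.
- by case: (c < b) / idP => // cb; rewrite /= ?orbF //; lra.
- by case: (a < b) / idP => //= ab; lra.
- by subst; rewrite orbb.
Qed.

(** Interiors commute with products, and the interior of a closed interval is the open one.
    Emptiness thus becomes a condition on the order of coordinates, and topology plays no part from
    here on. *)
Lemma rectangle_graphP (R : realType) (X : {fset R * R}) (p q : R * R) :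
  rectangle_graph X p q <->
  [/\ p \in X, q \in X, p != q & forall r, r \in X -> ~~ inside_box p q r].
Proof.
rewrite /rectangle_graph /empty_rectangle hull_rectangle2 interior_setX.
rewrite !interior_itv_bnd.
split=> -[pX qX pq empty]; split=> //.
- move=> r rX; apply/negP => /andP[r1 r2].
  suff : set0 r by [].
  by rewrite -empty; split=> //; split=> /=; rewrite itv_min_max_strictly_between.
- apply/seteqP; split=> [r [[/= r1 r2] /empty]|r //].
  by rewrite /inside_box -!itv_min_max_strictly_between r1 r2.
Qed.

Lemma rectangle_graph_sym (R : realType) (X : {fset R * R}) (p q : R * R) :
  rectangle_graph X p q -> rectangle_graph X q p.
Proof. by case=> pX qX pq; rewrite fsetUC eq_sym in pq * => empty; split. Qed.

Lemma mem_rectangle_graph_edges (R : realType) (X : {fset R * R})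
    (e : {fset R * R}) :
  e \in rectangle_graph_edges X <->
  exists p q, rectangle_graph X p q /\ e = [fset p; q].
Proof.
rewrite !inE /=; split=> [/andP[_ /asboolP]//|H].
apply/andP; split; last exact/asboolP.
case: H => p [q [[pX qX _ _] ->]]; rewrite fpowersetE.
by apply/fsubsetP => r /fset2P[] ->.
Qed.

(** * The upper bound *)

(** Say [r1] and [r2] are both above [p]. As [R[p,q]] is empty, they are above [q] too. The lower of
    the two would lie inside the box of the other with [p] if it is the left one, and with [q] if it
    is the right one. The case below [p] is symmetric. *)
Lemma common_neighbor_inj (R : realType) (X : {fset R * R})
    (p q r1 r2 : R * R) :
  generic X -> (forall r, r \in X -> p.1 <= r.1) ->
  rectangle_graph X p q ->
  (forall r, rectangle_graph X p r -> r.1 <= q.1) ->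
  rectangle_graph X p r1 -> rectangle_graph X q r1 ->
  rectangle_graph X p r2 -> rectangle_graph X q r2 ->
  (p.2 < r1.2) = (p.2 < r2.2) -> r1 = r2.
Proof.
move=> gX pmin pq qmax pr1 qr1 pr2 qr2 side; apply/eqP.
case: eqP => // /eqP r12.
have := qmax _ pr1; have := qmax _ pr2.
move/rectangle_graphP: pq => [pX qX /(gX _ _ pX qX)[p1q p2q] epq].
move/rectangle_graphP: pr1 => [_ r1X /(gX _ _ pX r1X)[p1r1 p2r1] epr1].
move/rectangle_graphP: pr2 => [_ r2X /(gX _ _ pX r2X)[p1r2 p2r2] epr2].
move/rectangle_graphP: qr1 => [_ _ /(gX _ _ qX r1X)[q1r1 q2r1] eqr1].
move/rectangle_graphP: qr2 => [_ _ /(gX _ _ qX r2X)[q1r2 q2r2] eqr2].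
have [r1r12 r2r12] := gX _ _ r1X r2X r12.
have := (epq _ r1X, epq _ r2X, epr1 _ r2X, epr2 _ r1X, eqr1 _ r2X, eqr2 _ r1X).
have : (p.1 < q.1) * (p.1 < r1.1) * (p.1 < r2.1).
  by rewrite !lt_neqAle !pmin // p1q p1r1 p1r2.
move=> [[px1 px2] px3] [[[[[]]]]].
rewrite /inside_box /strictly_between => i1 i2 i3 i4 i5 i6.
rewrite !le_eqVlt ![_ == q.1]eq_sym (negPf q1r1) (negPf q1r2) /= => x2 x1.
move: i1 i2 i3 i4 i5 i6 side.
rewrite ?px1 ?px2 ?px3 ?x1 ?x2 /=.
have nlt (a b : R) : a < b -> (b < a) = false.
  by move=> ab; apply/negbTE; rewrite -leNgt ltW.
rewrite ?(nlt _ _ px1, nlt _ _ px2, nlt _ _ px3, nlt _ _ x1, nlt _ _ x2) /=.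
(* Every relative order of the remaining coordinates puts r1 or r2 inside one of
   the boxes R[p,q], R[p,r1], R[p,r2], R[q,r1], R[q,r2]. *)
move: (lt_total p2q) (lt_total p2r1) (lt_total p2r2) (lt_total q2r1)
   (lt_total q2r2) (lt_total r1r12) (lt_total r2r12).
do 7 (let h := fresh "h" in case/orP=> h; rewrite ?h ?(nlt _ _ h) //=).
Qed.

Lemma seq_argmax (T : eqType) (R : realType) (f : T -> R) (s : seq T) :
  s != [::] -> exists2 x, x \in s & forall y, y \in s -> f y <= f x.
Proof.
elim: s => // a [|b s] IHs _.
  by exists a; rewrite ?inE // => y; rewrite inE => /eqP->.
have [x xs xmax] := IHs isT.
have [xa|ax] := leP (f x) (f a).
- exists a; rewrite ?inE ?eqxx // => y; rewrite inE => /predU1P[->//|ys].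
  exact: le_trans (xmax y ys) xa.
- exists x; rewrite 1?inE ?xs ?orbT // => y; rewrite inE => /predU1P[->|/xmax//].
  exact: ltW.
Qed.

Lemma card_gt1_neq (T : choiceType) (X : {fset T}) (p : T) :
  (1 < #|` X|)%N -> exists2 q, q \in X & p != q.
Proof.
move=> X2; have : (0 < #|` X `\ p|)%N.
  by move: X2; rewrite (cardfsD1 p); case: (p \in X); lia.
by rewrite cardfs_gt0 => /fset0Pn[q]; rewrite !inE eq_sym => /andP[? ?]; exists q.
Qed.

Lemma exists_removable_pair (R : realType) (X : {fset R * R}) :
  generic X -> (1 < #|` X|)%N ->
  exists p q, [/\ p \in X, q \in X, p != q &
    forall s : seq (R * R), uniq s ->
      (forall r, r \in s -> rectangle_graph X p r /\ rectangle_graph X q r) ->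
      (size s <= 2)%N].
Proof.
move=> gX X2.
have X0 : enum_fset X != [::] by apply: contraTneq X2; rewrite /= => ->.
have [p pX pmin] := seq_argmax _ _ (fun r : R * R => - r.1) _ X0.
pose N := [seq r <- enum_fset X | `[< rectangle_graph X p r >]].
have memN r : rectangle_graph X p r -> r \in N.
  by move=> pr; rewrite mem_filter (asboolT pr); case: pr.
(* If [p] has no neighbour, no common neighbour exists and any other point serves as [q]. *)
have [N0|/(seq_argmax _ _ (@fst R R) _)[q]] := eqVneq N [::].
  have [q qX pq] := card_gt1_neq _ X p X2.
  exists p, q; split=> // -[//|r s] _ /(_ r (mem_head r s))[/memN].
  by rewrite N0.
rewrite mem_filter => /andP[/asboolP pq qX] qmax.
exists p, q; split=> //; first by case: pq.
move=> s us sN.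
(* The side of [p] on which a common neighbour lies is a boolean that determines it, so there are at
   most two. *)
rewrite -(size_map (fun r : R * R => p.2 < r.2)).
apply: (@uniq_leq_size _ _ [:: true; false]); last by case; rewrite !inE.
rewrite map_inj_in_uniq // => r1 r2 /sN[pr1 qr1] /sN[pr2 qr2].
apply: (common_neighbor_inj _ _ _ _ _ _ gX _ pq) => // [r rX|r /memN/qmax//].
by rewrite -lerN2 pmin.
Qed.

(** The lost edges are at most [pq] and those from [p] or [q] into the rest [Y]. By
    inclusion-exclusion the latter number at most [#|Y|], plus the common neighbours in [Y]. The
    minimum sharpens the bound when [Y] has fewer than two points. *)
Lemma span2_remove_pair (R : realType) (X : {fset R * R}) (p q : R * R) :
  p \in X -> q \in X -> p != q ->
  (forall s : seq (R * R), uniq s ->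
     (forall r, r \in s -> rectangle_graph X p r /\ rectangle_graph X q r) ->
     (size s <= 2)%N) ->
  (span2 X <= span2 (X `\ p `\ q) + #|` X|.-1 + minn 2 (#|` X| - 2))%N.
Proof.
move=> pX qX pq common; set Y := X `\ p `\ q.
have cY : #|` X| = (#|` Y| + 2)%N.
  by rewrite (cardfsD1 p X) pX (cardfsD1 q (X `\ p)) in_fsetD1 eq_sym pq qX /Y; lia.
pose a r := `[< rectangle_graph X p r >].
pose b r := `[< rectangle_graph X q r >].
pose Np := [seq r <- enum_fset Y | a r]; pose Nq := [seq r <- enum_fset Y | b r].
(* [L] only has to cover the edges of [X]: repetitions, or [pq] not being an edge, do no harm to an
   upper bound. *)
pose L : seq {fset R * R} := enum_fset (rectangle_graph_edges Y) ++ [fset p; q] ::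
  [seq [fset p; r] | r <- Np] ++ [seq [fset q; r] | r <- Nq].
have memL e : (e \in L) = [|| e \in rectangle_graph_edges Y, e == [fset p; q],
    e \in [seq [fset p; r] | r <- Np] | e \in [seq [fset q; r] | r <- Nq]].
  apply: etrans (mem_cat _ _ _) _; congr (_ || _).
  by apply: etrans (in_cons _ _ _) _; congr (_ || _); apply: mem_cat.
have sub : {subset enum_fset (rectangle_graph_edges X) <= L}.
  have star u v : rectangle_graph X u v -> u \in [:: p; q] -> [fset u; v] \in L.
    move=> uv; have [_ vX _ _] := uv.
    have vY : v \notin [:: p; q] -> v \in Y.
      by rewrite !inE negb_or => /andP[-> ->].
    have uneqv : u != v by case: uv.
    rewrite memL !inE => /orP[] /eqP uE; subst u.
      have [->|vq] := eqVneq v q; first by rewrite eqxx orbT.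
      rewrite [X in [|| _, _, X | _]]map_f ?orbT // mem_filter /a asboolT //=.
      by apply: vY; rewrite !inE negb_or eq_sym uneqv.
    have [->|vp] := eqVneq v p; first by rewrite fsetUC eqxx orbT.
    rewrite [X in [|| _, _, _ | X]]map_f ?orbT // mem_filter /b asboolT //=.
    by apply: vY; rewrite !inE negb_or vp eq_sym.
  move=> e /mem_rectangle_graph_edges[u [v [uv ->]]].
  have [/(star _ _ uv)//|up] := boolP (u \in [:: p; q]).
  have [|vp] := boolP (v \in [:: p; q]).
    by rewrite fsetUC; apply: star; apply: rectangle_graph_sym.
  rewrite memL; apply/orP; left.
  (* An edge avoiding [p] and [q] survives, since deleting points keeps rectangles empty. *)
  apply/mem_rectangle_graph_edges; exists u, v; split=> //.
  move: up vp; rewrite !inE !negb_or => /andP[up uq] /andP[vp vq].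
  case/rectangle_graphP: uv => uX vX uv empty.
  apply/rectangle_graphP; split=> // [||r].
  - by rewrite !inE up uq.
  - by rewrite !inE vp vq.
  - by rewrite !inE => /and3P[_ _ /empty].
have le : (span2 X <=
    span2 Y + (count a (enum_fset Y) + count b (enum_fset Y)).+1)%N.
  have := uniq_leq_size (fset_uniq (rectangle_graph_edges X)) sub.
  by rewrite size_cat /= size_cat !size_map !size_filter.
have ab2 : (count (predI a b) (enum_fset Y) <= minn 2 (#|` X| - 2))%N.
  rewrite leq_min; apply/andP; split; last first.
    by rewrite cY addnK count_size.
  rewrite -size_filter; apply: common; first exact/filter_uniq/fset_uniq.
  by move=> r; rewrite mem_filter => /andP[/andP[/asboolP ? /asboolP ?] _].
rewrite -count_predUI in le; apply: leq_trans le _.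
rewrite -addnA leq_add2l -addSn leq_add //.
by rewrite cY addn2 /= ltnS count_size.
Qed.

Lemma span2_small (R : realType) (X : {fset R * R}) :
  (#|` X| <= 1)%N -> span2 X = 0%N.
Proof.
move=> X1; apply/eqP; rewrite cardfs_eq0; apply/eqP/fsetP => e.
apply/negP => /mem_rectangle_graph_edges[p [q [[pX qX pq _] _]]].
have := fsubset_leq_card (_ : [fset p; q] `<=` X).
rewrite cardfs2 pq => H; suff : (2 <= 1)%N by [].
apply: leq_trans X1; apply: H.
by apply/fsubsetP => r /fset2P[] ->.
Qed.

(** This is the bound multiplied by 4, without floor or subtraction. The induction step is tight:
    from [n - 2] to [n] the right-hand side grows by exactly [4 * (n + 1)]. *)
Lemma span2_upper_bound (R : realType) (X : {fset R * R}) :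
  generic X -> (2 <= #|` X|)%N ->
  (4 * span2 X + 8 <= #|` X| ^ 2 + 4 * #|` X|)%N.
Proof.
move: {-1}#|` X| (erefl #|` X|) => n; elim/ltn_ind: n X => n IHn X cX gX n2.
have [|p [q [pX qX pq common]]] := exists_removable_pair _ X gX; first by rewrite cX.
have := span2_remove_pair _ X p q pX qX pq common; rewrite cX.
set Y := X `\ p `\ q.
have cY : #|` Y| = (n - 2)%N.
  by rewrite -cX (cardfsD1 p X) pX (cardfsD1 q (X `\ p)) in_fsetD1 eq_sym pq qX
    -/Y !addnA addnC addnK.
have gY : generic Y.
  by move=> u v; rewrite !inE => /and3P[_ _ uX] /and3P[_ _ vX]; exact: gX.
have [n4|n4] := leqP 4 n; last first.
  (* Base cases [n = 2] and [n = 3]: at most one point remains, so only the removed edges count. *)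
  rewrite (span2_small _ Y); last by rewrite cY; lia.
  by case: n n2 n4 {IHn cX cY} => [|[|[|[|]]]] // _ _; lia.
have {IHn} IH : (4 * span2 Y + 8 <= (n - 2) ^ 2 + 4 * (n - 2))%N.
  by apply: IHn => //; lia.
have [m nE] : exists m, n = (m + 4)%N by exists (n - 4)%N; lia.
move: IH; rewrite {}nE (_ : (m + 4 - 2 = m + 2)%N); last by lia.
rewrite (minn_idPl _); last by lia.
move: (span2 X) (span2 Y) => x y; nia.
Qed.

(** * The extremal configuration *)

(** For [i < n] the heights are at most [n] on the first chain and above [2 * n] on the second, so
    the second chain lies entirely above the first. *)
Definition chain_height (n k i : nat) : nat :=
  (if i < k then n - i else 3 * n - i)%N.

Definition chain_point (R : realType) (n k i : nat) : R * R :=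
  (i%:R, (chain_height n k i)%:R).

Definition two_chains (R : realType) (n k : nat) : {fset R * R} :=
  seq_fset tt [seq chain_point R n k i | i <- iota 0 n].

Lemma chain_point_inj (R : realType) (n k : nat) :
  injective (chain_point R n k).
Proof. by move=> i j [/eqP]; rewrite eqr_nat => /eqP. Qed.

Lemma two_chainsP (R : realType) (n k : nat) (p : R * R) :
  reflect (exists2 i, (i < n)%N & p = chain_point R n k i)
          (p \in two_chains R n k).
Proof.
rewrite seq_fsetE; apply: (iffP mapP) => -[i].
  by rewrite mem_iota => ? ->; exists i.
by move=> ? ->; exists i; rewrite ?mem_iota.
Qed.

Lemma card_two_chains (R : realType) (n k : nat) : #|` two_chains R n k| = n.
Proof.
rewrite size_seq_fset undup_id ?size_map ?size_iota //.
by rewrite map_inj_uniq ?iota_uniq //; apply: chain_point_inj.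
Qed.

Lemma generic_two_chains (R : realType) (n k : nat) :
  generic (two_chains R n k).
Proof.
move=> _ _ /two_chainsP[i ni ->] /two_chainsP[j nj ->] pij.
have ij : i != j by apply: contraNneq pij => ->.
by split; rewrite /= eqr_nat // /chain_height; do 2 case: ifP => ?; lia.
Qed.

(** Consecutive points have no abscissa between them. For a pair across the chains, a point with
    abscissa in between is below point [i] if on the first chain and above point [j] if on the
    second. *)
Lemma two_chains_edge (R : realType) (n k i j : nat) :
  (i < j < n)%N -> j = i.+1 \/ (i < k <= j)%N ->
  [fset chain_point R n k i; chain_point R n k j]
    \in rectangle_graph_edges (two_chains R n k).
Proof.
move=> ijn H; apply/mem_rectangle_graph_edges.
exists (chain_point R n k i), (chain_point R n k j); split=> //.
apply/rectangle_graphP; split.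
- by apply/two_chainsP; exists i => //; lia.
- by apply/two_chainsP; exists j => //; lia.
- by rewrite (inj_eq (@chain_point_inj R n k)); lia.
- move=> _ /two_chainsP[m mn ->].
  rewrite /inside_box /strictly_between /= !ltr_nat /chain_height.
  by case: H => H; do 3 case: ifP => ?; lia.
Qed.

(** The consecutive pair [(k.-1, k)] joins the two chains and is already in the first list; the
    second list skips it to avoid counting it twice. *)
Definition chain_pairs (k l : nat) : seq (nat * nat) :=
  [seq (i, j) | i <- iota 0 k, j <- iota k l] ++
  [seq (i, i.+1) | i <- iota 0 k.-1 ++ iota k l.-1].

Lemma size_chain_pairs (k l : nat) :
  size (chain_pairs k l) = (k * l + (k.-1 + l.-1))%N.
Proof. by rewrite size_cat size_allpairs size_map size_cat !size_iota. Qed.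

Lemma chain_pairsP (k l i j : nat) : (0 < k)%N -> (0 < l)%N ->
  (i, j) \in chain_pairs k l ->
  (i < j < k + l)%N /\ (j = i.+1 \/ (i < k <= j)%N).
Proof.
move=> k0 l0; rewrite mem_cat => /orP[/allpairsP[[a b] /= []]|/mapP[a]].
  by rewrite !mem_iota => ? ? [-> ->]; split; [|right]; lia.
by rewrite mem_cat !mem_iota => ? [-> ->]; split; [|left]; lia.
Qed.

Lemma chain_pairs_uniq (k l : nat) : uniq (chain_pairs k l).
Proof.
rewrite cat_uniq; apply/and3P; split.
- by apply: allpairs_uniq; rewrite ?iota_uniq // => -[? ?] [? ?].
- apply/hasPn => _ /mapP[a + ->]; rewrite mem_cat !mem_iota => H.
  apply/negP => /allpairsP[[b c] /= []].
  by rewrite !mem_iota => ? ? [? ?]; lia.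
- rewrite map_inj_uniq; last by move=> ? ? [].
  rewrite cat_uniq !iota_uniq andbT; apply/hasPn => a.
  by rewrite !mem_iota; lia.
Qed.

Lemma span2_two_chains_ge (R : realType) (k l : nat) :
  (0 < k)%N -> (0 < l)%N ->
  (k * l + (k.-1 + l.-1) <= span2 (two_chains R (k + l) k))%N.
Proof.
move=> k0 l0; pose P := chain_point R (k + l) k.
pose edge (ij : nat * nat) := [fset P ij.1; P ij.2].
have Pin a b c : P a \in [fset P b; P c] -> (a == b) || (a == c).
  by rewrite !inE !(inj_eq (@chain_point_inj R _ _)).
rewrite -size_chain_pairs -(size_map edge).
apply: uniq_leq_size; last first.
  move=> _ /mapP[[i j] /(chain_pairsP _ _ _ _ k0 l0)[ij H] ->].
  exact: two_chains_edge.
(* An edge is an unordered pair; since all listed pairs are increasing, it determines its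
   indices. *)
rewrite map_inj_in_uniq ?chain_pairs_uniq // => -[a b] [c d].
move=> /(chain_pairsP _ _ _ _ k0 l0)[ab _] /(chain_pairsP _ _ _ _ k0 l0)[cd _] E.
have /Pin H1 : P a \in edge (c, d) by rewrite -E fset21.
have /Pin H2 : P b \in edge (c, d) by rewrite -E fset22.
by move: H1 H2 => /= H1 H2; congr (_, _); lia.
Qed.

Lemma floor_bound_eq (R : realType) (n m : nat) :
  (4 * m + 8 <= n ^ 2 + 4 * n < 4 * m + 12)%N ->
  Num.floor (n%:R ^+ 2 / 4 + n%:R - 2 : R) = m%:Z.
Proof.
move=> /andP[]; rewrite -(ler_nat R) -(ltr_nat R) !natrD natrX => lo hi.
apply: floor_def; rewrite intrD -!pmulrn; lra.
Qed.

Theorem theorem1 (R : realType) :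
  (forall n : nat, (2 <= n)%N ->
     forall X : {fset R * R}, generic X -> #|` X| = n ->
       (span2 X)%:Z <= Num.floor (n%:R ^+ 2 / 4 + n%:R - 2 : R)) /\
  (forall n : nat, (2 <= n)%N ->
     exists X : {fset R * R},
       [/\ generic X, #|` X| = n &
           (span2 X)%:Z = Num.floor (n%:R ^+ 2 / 4 + n%:R - 2 : R)]).
Proof.
split=> [n n2 X gX cX|n n2].
  have := span2_upper_bound _ X gX; rewrite cX => /(_ n2).
  rewrite floor_ge_int -(ler_nat R) !natrD natrX -pmulrn.
  by move=> ?; lra.
pose k := n./2; pose l := (n - k)%N.
have k0 : (0 < k)%N by rewrite /k; lia.
have l0 : (0 < l)%N by rewrite /l /k; lia.
have nE : n = (k + l)%N by rewrite /l /k; lia.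
have kl : l = k \/ l = k.+1 by rewrite /l /k; lia.
have gX := generic_two_chains R n k; have cX := card_two_chains R n k.
exists (two_chains R n k); split=> //.
have := span2_upper_bound _ _ gX; rewrite cX => /(_ n2) up.
have lo := span2_two_chains_ge R _ _ k0 l0; rewrite -nE in lo.
apply/esym/floor_bound_eq; rewrite up /=.
move: (span2 _) lo {up gX cX} => m lo.
(* The strict inequality amounts to [n ^ 2 - 4 * k * l = (l - k) ^ 2 < 4], which holds as [l - k] is
   0 or 1. *)
by clearbody k l; subst n; case: kl => E; subst l; nia.
Qed.
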